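(* No learning algorithm $\mathcal{M}:\mathcal{D}\to\mathcal{R}$ can simultaneously satisfy $\epsilon$-differential privacy (with $\epsilon<\infty$) and guarantee to generate a fair (in the sense of equal opportunity) classifier which is non-trivial.
   Context: Data universe: $\mathcal{X}$ is the set of all possible data elements $z=(x,a,y)$, where $x\in X$ are the element's (non-sensitive) features, $a\in A$ is the sensitive feature, and $y\in Y$ is the actual outcome (label). The sensitive feature and the label are binary, with values in $\{0,1\}$ ($A=0$ is the non-protected group, $A=1$ the protected group; $Y=1$ is a positive instance, $Y=0$ a negative one). The letters $X,A,Y$ also denote the corresponding random variables. Classifier: a binary classifier is a map $h:\mathcal{X}\to\{0,1\}$ that tries to predict the true outcome $y$ of a data element $z$; its predicted outcome is denoted $\hat{Y}$. Trivial classifier: $h$ is trivial if it outputs the same outcome independently from the data element inputs, i.e. $\mathbb{P}[h(z)=\hat{y}]=\mathbb{P}[h(z')=\hat{y}]$ for all $z,z'\in\mathcal{X}$ and $\hat{y}\in\{0,1\}$; otherwise it is non-trivial. Datasets and adjacency: a dataset $D$ can be defined in two ways, each leading to its own notion of adjacency. (1) A dataset is a finite set of samples $D=\{z_1,z_2,\ldots,z_n\}$ drawn from a distribution over $\mathcal{X}$; then $D$ and $D'$ are adjacent if they differ in exactly one data element, i.e. $z_i\neq z_i'$ for exactly one $i\in\{1,\ldots,n\}$. (2) A dataset is a distribution over $\mathcal{X}$; then $D$ and $D'$ are adjacent ($\zeta$-close) if $\frac12\sum_{z\in\mathcal{X}}|D(z)-D'(z)|\le\zeta$, where $D(z)$ is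 the probability of $z$ under $D$. Learning algorithm and differential privacy: $\mathcal{D}$ is the set of all possible datasets and $\mathcal{R}$ the set of all possible trained classifiers. A learning algorithm $\mathcal{M}:\mathcal{D}\to\mathcal{R}$ (whose output may be random) satisfies $\epsilon$-differential privacy, where $\epsilon<\infty$, if for any two adjacent datasets $D,D'\in\mathcal{D}$ and any subset of models $S\subseteq\mathcal{R}$, $\mathbb{P}[\mathcal{M}(D)\in S]\le e^{\epsilon}\,\mathbb{P}[\mathcal{M}(D')\in S]$. Equal opportunity (fairness): a classifier with predicted outcome $\hat{Y}$ is fair on a dataset if, with respect to that dataset, $\mathbb{P}[\hat{Y}=1\mid Y=1,A=0]=\mathbb{P}[\hat{Y}=1\mid Y=1,A=1]$.
   Formalization: Classifiers see only (x,a), since h(z)=y would refute the claim; samples have fixed size n≥2 and ζ>0; either the feature set is countable or the law of M(D) is discrete, as a random point-indicator on [0,1] refutes the claim otherwise. *)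

(* Defs.v *)
From HB Require Import structures.
From mathcomp Require Import all_boot all_order all_algebra.
From mathcomp Require Import all_classical all_reals all_analysis.

Set Implicit Arguments.
Unset Strict Implicit.
Unset Printing Implicit Defensive.

Import Order.TTheory GRing.Theory Num.Theory.

Local Open Scope classical_set_scope.
Local Open Scope ring_scope.

(* The data universe: z = ((x, a), y), with a and y binary
   (true = 1, false = 0). *)
Definition elem (X : Type) : Type := (X * bool * bool)%type.

Definition sensitive (X : Type) (z : elem X) : bool := z.1.2.
Definition label (X : Type) (z : elem X) : bool := z.2.

(* A classifier predicts the label of z, so its input is the part (x, a) of z.
   If it could also read y, then h(x, a, y) = y would be non-trivial and fair
   on every dataset. *)
Notation classifier X := (X * bool -> bool).

Definition predict (X : Type) (h : classifier X) (z : elem X) : bool := h z.1.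

(* Since h is a map, the probability of the event h(z) = yhat is 1 or 0
   according to the truth value of [predict h z == yhat]. *)
Definition trivial_classifier (X : Type) (h : classifier X) : Prop :=
  forall (z z' : elem X) (yhat : bool),
    (predict h z == yhat) = (predict h z' == yhat).

Section EqualOpportunity.
Context {R : realType} {X : Type}.

Definition cond_prob (P : set (elem X) -> R) (E F : set (elem X)) : R :=
  P (E `&` F) / P F.

Definition positive_group (a : bool) : set (elem X) :=
  [set z | label z = true /\ sensitive z = a].

(* P gives the probability of an event under a dataset.  Nothing is required
   when one of the two conditional probabilities is undefined. *)
Definition equal_opportunity (P : set (elem X) -> R) (h : classifier X) :
    Prop :=
  0 < P (positive_group false) -> 0 < P (positive_group true) ->
  cond_prob P [set z | predict h z = true] (positive_group false) =
  cond_prob P [set z | predict h z = true] (positive_group true).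

End EqualOpportunity.

(* Datasets as n samples, repetitions allowed.  A sample of size n < 2 never
   contains positive elements of both groups, so that equal opportunity says
   something only for n >= 2. *)
Definition sample (X : Type) (n : nat) : Type := n.-tuple (elem X).

Definition sample_prob (R : realType) (X : Type) (n : nat) (D : sample X n)
    (E : set (elem X)) : R :=
  (\sum_(i < n) \1_E (tnth D i)) / n%:R.

Definition sample_adjacent (X : Type) (n : nat) (D D' : sample X n) : Prop :=
  exists! i : 'I_n, tnth D i <> tnth D' i.

(* Datasets as (discrete) distributions. *)
Record distr (R : realType) (T : choiceType) := Distr {
  distr_fun :> T -> R ;
  distr_ge0 : forall t, 0 <= distr_fun t ;
  distr_sum1 : ((\esum_(t in [set: T]) (distr_fun t)%:E) = 1)%E }.

Definition distr_prob (R : realType) (T : choiceType) (D : distr R T)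
    (E : set T) : R :=
  fine (\esum_(t in E) (D t)%:E)%E.

(* The total variation distance is at most zeta.  For zeta = 0 a dataset is
   adjacent to itself only, and differential privacy says nothing. *)
Definition distr_close (R : realType) (T : choiceType) (zeta : R)
    (D D' : distr R T) : Prop :=
  ((2^-1)%:E * (\esum_(t in [set: T]) `|D t - D' t|%:E) <= zeta%:E)%E.

(* A learning algorithm maps a dataset to the law of the trained classifier, a
   probability on the set of all classifiers equipped with the sigma-algebra
   generated by G.  For G = setT every set of classifiers is measurable. *)
Definition algorithm (R : realType) (X : pointedType)
    (G : set (set (classifier X))) (dataset : Type) : Type :=
  dataset -> probability (g_sigma_algebraType G) R.

Section Learning.
Context {R : realType} {X : pointedType} {G : set (set (classifier X))}.
Context {dataset : Type}.

Definition differentially_private (adj : dataset -> dataset -> Prop) (eps : R)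
    (M : algorithm R G dataset) : Prop :=
  forall (D D' : dataset) (S : set (g_sigma_algebraType G)),
    adj D D' -> measurable S ->
    (M D S <= (expR eps)%:E * M D' S)%E.

(* [prob D] gives the probabilities of events under D; fairness is required on
   the dataset from which the classifier is learned. *)
Definition guarantees_fair_nontrivial
    (prob : dataset -> set (elem X) -> R) (M : algorithm R G dataset) : Prop :=
  forall D : dataset, {ae M D, forall h : g_sigma_algebraType G,
    equal_opportunity (prob D) h /\ ~ trivial_classifier h}.

(* When X is uncountable and the law of M(D) is not discrete, the impossibility
   fails for G made of the sets {h | h v = b} and the two sets {h} with h
   constant: for u uniform in X = [0, 1], independently of the data, the
   non-trivial classifier h(x, a) = 1_(x = u) almost surely vanishes on any
   given countable set, hence is almost surely fair on any given dataset. *)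
Definition discretely_random (M : algorithm R G dataset) : Prop :=
  forall D : dataset, exists2 C : set (g_sigma_algebraType G), countable C &
    {ae M D, forall h : g_sigma_algebraType G, C h}.

End Learning.

(* Main.v *)
(* Privacy with a finite epsilon transports null events along adjacent datasets.
   Start from a dataset containing negative elements only, and reach from it by
   adjacency steps a dataset whose only positive elements are (x, 0) and
   (x', 1).  Fairness on the latter says exactly h(x, 0) = h(x', 1), so this
   equality holds almost surely under the law learned from the initial dataset,
   for every x and x'.  Countability of the features, or of the set of possible
   classifiers, makes countably many of these null events cover all non-trivial
   classifiers. *)
Require Import Defs.
From mathcomp Require Import all_boot all_order all_algebra.
From mathcomp Require Import all_classical all_reals all_analysis.
From mathcomp Require Import ring lra.

Set Implicit Arguments.
Unset Strict Implicit.
Unset Printing Implicit Defensive.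

Import Order.TTheory GRing.Theory Num.Theory.

Local Open Scope classical_set_scope.
Local Open Scope ring_scope.

Definition disagreement {X : Type} (x x' : X) : set (classifier X) :=
  [set h | h (x, false) != h (x', true)].

(** Two inputs of the same group are compared through an input of the other group, so agreement
    across the groups already makes [h] constant. *)
Lemma nontrivial_disagreement (X : Type) (h : classifier X) :
  ~ trivial_classifier h -> exists x x', disagreement x x' h.
Proof.
apply: contra_notP => agree.
have heq x x' : h (x, false) = h (x', true).
  by apply/eqP/negP => /negP dis; apply: agree; exists x, x'.
move=> [[x a] y] [[x' a'] y'] yhat; rewrite /predict /=; congr (_ == _).
by case: a a' => [] [] //; rewrite ?(heq x x') // -?(heq x) // (heq x x').
Qed.

(** * Null events covering the non-trivial classifiers *)

Section NullDisagreements.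
Context {R : realType} {X : pointedType} {G : set (set (classifier X))}.

Lemma measurable_disagreement (x x' : X) :
  (forall v b, G.-sigma.-measurable [set h | h v = b]) ->
  measurable (disagreement x x' : set (g_sigma_algebraType G)).
Proof.
move=> hG.
have -> : disagreement x x' =
    ([set h | h (x, false) = true] `&` [set h | h (x', true) = false]) `|`
    ([set h | h (x, false) = false] `&` [set h | h (x', true) = true]).
  apply/seteqP; split=> h; rewrite /disagreement /=.
    by case: (h (x, false)) (h (x', true)) => [] []; [|left|right|].
  by move=> [] [-> ->].
by apply: measurableU; apply: measurableI; exact: hG.
Qed.

(** For countable [X] all pairs of features are enumerated; otherwise one witnessing pair is chosen
    for each classifier of the countable set [C]. *)
Lemma countable_disagreements_cover (P : probability (g_sigma_algebraType G) R) :
  countable [set: X] \/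
    (exists2 C : set (g_sigma_algebraType G), countable C &
       {ae P, forall h : g_sigma_algebraType G, C h}) ->
  exists f : nat -> X * X, {ae P, forall h : g_sigma_algebraType G,
    ~ trivial_classifier h -> exists n, disagreement (f n).1 (f n).2 h}.
Proof.
case=> [cX|[C cC aeC]].
  have /pcard_surjP[f fsurj] := countableX cX cX.
  exists f; apply: aeW => h /nontrivial_disagreement[x [x' dis]].
  by have [//|n _ fn] := fsurj (x, x'); exists n; rewrite fn.
have /(@pcard_surjP (classifier X))[g gsurj] := cC.
(* The enumeration [g] may meet trivial classifiers; these get the dummy pair [(point, point)]. *)
have /choice[f fP] (n : nat) : exists p : X * X,
    ~ trivial_classifier (g n) -> disagreement p.1 p.2 (g n).
  have [tri|/nontrivial_disagreement[x [x' dis]]] :=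
    pselect (trivial_classifier (g n)); first by exists (point, point).
  by exists (x, x').
exists f; apply: filterS aeC => h /gsurj[n _ <-] /fP; by exists n.
Qed.

Lemma null_disagreements_trivial
    (P : probability (g_sigma_algebraType G) R) :
  countable [set: X] \/
    (exists2 C : set (g_sigma_algebraType G), countable C &
       {ae P, forall h : g_sigma_algebraType G, C h}) ->
  (forall x x', P (disagreement x x') = 0%E) ->
  (forall v b, G.-sigma.-measurable [set h | h v = b]) ->
  ~ {ae P, forall h : g_sigma_algebraType G, ~ trivial_classifier h}.
Proof.
move=> /countable_disagreements_cover[f cover] null hG nontriv.
have agree : {ae P, forall h : g_sigma_algebraType G,
    forall n, ~ disagreement (f n).1 (f n).2 h}.
  apply: ae_foralln => n; exists (disagreement (f n).1 (f n).2).
  split; [exact: measurable_disagreement | exact: null|].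
  by move=> h /contrapT.
(* Three almost sure properties contradict each other, so the whole space is null, against total
   mass 1. *)
have [N [mN N0 subN]] : {ae P, forall h : g_sigma_algebraType G, False}.
  apply: filterS3 cover agree nontriv => h hcover hagree /hcover[n].
  exact: hagree.
have NT : N = setT by apply/seteqP; split=> // h _; apply: subN.
by move/eqP: N0; rewrite NT probability_setT onee_eq0.
Qed.

(** Nullity passes from [D'] back to [D]: chains of adjacent datasets are followed from the one with
    positive elements to the initial one. *)
Lemma private_null (dataset : Type) (adj : dataset -> dataset -> Prop)
    (eps : R) (M : algorithm R G dataset) (D D' : dataset)
    (S : set (g_sigma_algebraType G)) :
  differentially_private adj eps M -> adj D D' -> measurable S ->
  M D' S = 0%E -> M D S = 0%E.
Proof.
move=> priv adjDD' mS null; apply/eqP.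
by rewrite eq_le measure_ge0 andbT (le_trans (priv _ _ _ adjDD' mS))// null mule0.
Qed.

End NullDisagreements.

(** * Fairness with one positive element in each group *)

Section TwoPositives.
Context {R : realType} {X : pointedType}.

Definition negative_elem : elem X := (point, false, false).

(** Common interface of the two notions of dataset: the weight [a] is left free so that both samples
    and distributions fit. *)
Definition two_positives_prob (p : set (elem X) -> R) (x x' : X) : Prop :=
  exists a b, 0 < b /\ forall E, p E = a * \1_E negative_elem +
    b * \1_E (x, false, true) + b * \1_E (x', true, true).

(** The positives of each group reduce to one point of mass [b > 0], so each conditional probability
    is defined and equals the 0/1 value of [h] at that point. *)
Lemma equal_opportunity_agree (p : set (elem X) -> R) (x x' : X)
    (h : classifier X) :
  two_positives_prob p x x' -> equal_opportunity p h -> ~ disagreement x x' h.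
Proof.
move=> [a [b [b_gt0 pE]]].
have indicT (E : set (elem X)) z : E z -> \1_E z = 1 :> R.
  by move=> Ez; rewrite indicE mem_set.
have indicF (E : set (elem X)) z : ~ E z -> \1_E z = 0 :> R.
  by move=> Ez; rewrite indicE memNset.
have indic_pred z : \1_[set z | predict h z = true] z = (predict h z)%:R :> R.
  by rewrite indicE; congr (nat_of_bool _)%:R; apply/idP/idP; rewrite inE.
have indicM (E : set (elem X)) c z : \1_(E `&` positive_group c) z =
    \1_E z * \1_(positive_group c) z :> R by rewrite indicI.
rewrite /equal_opportunity /cond_prob !pE !indicM.
have neg a' : \1_(positive_group a') (negative_elem : elem X) = 0 :> R.
  by rewrite indicF// => -[].
have pos a' (y : X) : \1_(positive_group a') (y, a', true) = 1 :> R by rewrite indicT.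
have pos' a' (y : X) : \1_(positive_group a') (y, ~~ a', true) = 0 :> R.
  by rewrite indicF//; case: a' => -[].
rewrite !neg !pos (pos' true) (pos' false).
rewrite !indic_pred !mulr0 !mulr1 !add0r !addr0 => /(_ b_gt0 b_gt0).
rewrite /predict /= ![b * _]mulrC !mulfK ?gt_eqF// => /eqP.
rewrite eqr_nat /disagreement /=.
by case: (h (x, false)); case: (h (x', true)).
Qed.

Lemma fair_null_disagreement (G : set (set (classifier X))) (dataset : Type)
    (prob : dataset -> set (elem X) -> R) (M : algorithm R G dataset)
    (D : dataset) (x x' : X) :
  (forall v b, G.-sigma.-measurable [set h | h v = b]) ->
  guarantees_fair_nontrivial prob M -> two_positives_prob (prob D) x x' ->
  M D (disagreement x x') = 0%E.
Proof.
move=> hG fair pD.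
(* The disagreement event lies in the exceptional set of the fairness guarantee; being measurable,
   it then has measure zero. *)
apply: measure_negligible; first exact: measurable_disagreement.
apply: negligibleS (fair D) => h dis [eo _].
exact: equal_opportunity_agree pD eo dis.
Qed.

End TwoPositives.

(** * Adjacent samples *)

Section Samples.
Context {X : Type}.

Lemma sample_adjacent_head (n : nat) (a b : elem X) (s : sample X n) :
  a <> b -> sample_adjacent (cons_tuple a s) (cons_tuple b s).
Proof.
move=> ab; exists ord0; split=> [|i]; first by rewrite !tnth0.
by case: (unliftP ord0 i) => [j ->|->//]; rewrite !tnthS.
Qed.

Lemma sample_adjacent_cons (n : nat) (a : elem X) (s s' : sample X n) :
  sample_adjacent s s' -> sample_adjacent (cons_tuple a s) (cons_tuple a s').
Proof.
move=> [j [dj uniq_j]]; exists (lift ord0 j); split=> [|i]; first by rewrite !tnthS.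
case: (unliftP ord0 i) => [k ->|->]; last by rewrite !tnth0.
by rewrite !tnthS => /uniq_j ->.
Qed.

End Samples.

Lemma sample_prob_two_positives (R : realType) (X : pointedType) (n : nat)
    (x x' : X) :
  two_positives_prob (sample_prob R (cons_tuple (x, false, true)
    (cons_tuple (x', true, true) (nseq_tuple n negative_elem)))) x x'.
Proof.
exists (n%:R / n.+2%:R), n.+2%:R^-1; split=> [|E]; first by rewrite invr_gt0.
rewrite /sample_prob !big_ord_recl !tnthS !tnth0.
under eq_bigr do rewrite !tnthS tnth_nseq.
rewrite sumr_const card_ord -mulr_natl; ring.
Qed.

(** * Distributions carried by at most three points *)

Section ThreePoints.
Context {R : realType} {T : choiceType}.

Lemma esum_mul_pred1 (A : set T) (c : R) (a : T) :
  0 <= c -> (\esum_(t in A) (c * (t == a)%:R)%:E = (c * \1_A a)%:E)%E.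
Proof.
move=> c_ge0; rewrite esum_mkcond.
(* Extended by zero to all of [T], both sums have the same terms. *)
transitivity (\esum_(t in [set a]) (c * \1_A t)%:E)%E; last first.
  by rewrite esum_set1// lee_fin mulr_ge0// indicE.
rewrite [RHS]esum_mkcond; apply: eq_esum => t _.
rewrite in_set1 indicE; case: eqVneq => [->|_]; last first.
  by rewrite mulr0; case: ifP.
by case: ifP; rewrite ?mulr1 ?mulr0.
Qed.

(** The points may coincide, in which case their masses add up; point masses are thus included. *)
Definition three_points (a b : R) (z0 z1 z2 : T) (z : T) : R :=
  a * (z == z0)%:R + b * (z == z1)%:R + b * (z == z2)%:R.

Lemma three_points_ge0 a b z0 z1 z2 z :
  0 <= a -> 0 <= b -> 0 <= three_points a b z0 z1 z2 z.
Proof. by move=> a_ge0 b_ge0; rewrite !addr_ge0 ?mulr_ge0. Qed.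

Lemma esum_three_points (A : set T) a b z0 z1 z2 : 0 <= a -> 0 <= b ->
  (\esum_(z in A) (three_points a b z0 z1 z2 z)%:E =
   (a * \1_A z0 + b * \1_A z1 + b * \1_A z2)%:E)%E.
Proof.
move=> a_ge0 b_ge0.
have ge0 c z z' : 0 <= c -> (0 <= (c * (z == z' :> T)%:R)%:E)%E.
  by move=> c_ge0; rewrite lee_fin mulr_ge0.
under eq_esum do rewrite /three_points !EFinD.
rewrite esumD; [|by move=> z _; rewrite adde_ge0 ?ge0|by move=> z _; exact: ge0].
rewrite esumD; [|by move=> z _; exact: ge0..].
by rewrite !esum_mul_pred1// !EFinD.
Qed.

Lemma three_points_distr (t : R) (z0 z1 z2 : T) : 0 <= t <= 1 ->
  exists D : distr R T, D =1 three_points (1 - t) (t / 2) z0 z1 z2.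
Proof.
move=> t01.
have a_ge0 : 0 <= 1 - t by lra.
have b_ge0 : 0 <= t / 2 by lra.
unshelve eexists (@Distr R T (three_points (1 - t) (t / 2) z0 z1 z2) _ _) => //.
  by move=> z; exact: three_points_ge0.
by rewrite esum_three_points// !indicT !mulr1; congr EFin; lra.
Qed.

(** Moving mass [t] away from [z0] changes the weights by [t], [t / 2] and [t / 2], at most [2 * t]
    in total, which the factor 1/2 brings down to [t]. *)
Lemma distr_close_three_points (zeta t : R) (z0 z1 z2 : T) (D D' : distr R T) :
  0 <= t <= zeta ->
  D =1 three_points 1 0 z0 z1 z2 ->
  D' =1 three_points (1 - t) (t / 2) z0 z1 z2 ->
  distr_close zeta D D'.
Proof.
move=> /andP[t_ge0 t_le] DE D'E.
have b_ge0 : 0 <= t / 2 by lra.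
have le_sum : (\esum_(z in [set: T]) `|D z - D' z|%:E <= (2 * t)%:E)%E.
  have -> : 2 * t = t * \1_[set: T] z0 + t / 2 * \1_[set: T] z1 +
      t / 2 * \1_[set: T] z2 by rewrite !indicT !mulr1; lra.
  rewrite -esum_three_points//; apply: le_esum => z _.
  rewrite lee_fin DE D'E /three_points ler_norml.
  by case: (z == z0); case: (z == z1); case: (z == z2) => /=; lra.
apply: le_trans (lee_wpmul2l _ le_sum) _; first by rewrite lee_fin.
by rewrite -EFinM lee_fin mulKf.
Qed.

End ThreePoints.

Theorem proposition4 (R : realType) (X : pointedType)
    (G : set (set (classifier X)))
    (hG : forall (v : X * bool) (b : bool),
       G.-sigma.-measurable [set h | h v = b])
    (eps : R) :
  (forall (n : nat) (M : algorithm R G (sample X n)), (1 < n)%N ->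
     countable [set: X] \/ discretely_random M ->
     ~ (differentially_private (@sample_adjacent X n) eps M /\
        guarantees_fair_nontrivial (@sample_prob R X n) M)) /\
  (forall (zeta : R) (M : algorithm R G (distr R (elem X))), 0 < zeta ->
     countable [set: X] \/ discretely_random M ->
     ~ (differentially_private (@distr_close R _ zeta) eps M /\
        guarantees_fair_nontrivial (@distr_prob R _) M)).
Proof.
split=> [n M n_gt1 disc [priv fair]|zeta M zeta_gt0 disc [priv fair]].
- case: n n_gt1 M disc priv fair => [|[|n]]// _ M disc priv fair.
  pose N := nseq_tuple n (@negative_elem X).
  (* [D0] does not involve [x] and [x'], so all disagreement events become null under the single law
     [M D0]. *)
  pose D0 := cons_tuple negative_elem (cons_tuple negative_elem N).
  have nontriv : {ae M D0, forall h : g_sigma_algebraType G,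
      ~ trivial_classifier h} by apply: filterS (fair D0) => h [].
  apply: null_disagreements_trivial nontriv => //.
    by case: disc => [|/(_ D0)]; [left|right].
  move=> x x'; have mS := measurable_disagreement x x' hG.
  (* Each step from [D0] to [D1] to [D2] replaces one negative entry by a positive one. *)
  pose D1 := cons_tuple negative_elem (cons_tuple (x', true, true) N).
  pose D2 := cons_tuple (x, false, true) (cons_tuple (x', true, true) N).
  apply: (private_null (D' := D1) priv) => //.
    exact/sample_adjacent_cons/sample_adjacent_head.
  apply: (private_null (D' := D2) priv) => //.
    exact: sample_adjacent_head.
  exact: fair_null_disagreement (sample_prob_two_positives _ _ _ _).
(* The bound 1 keeps [1 - t] a mass, and the bound [zeta] makes one adjacency step enough. *)
- pose t := Num.min zeta 1.
  have t01 : 0 < t <= 1 by rewrite lt_min zeta_gt0 ltr01 ge_min lexx orbT.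
  have t_le : t <= zeta by rewrite ge_min lexx.
  (* Parameter 0 and three equal points: [D0] is the point mass at [negative_elem], again
     independent of [x] and [x']. *)
  have /(three_points_distr negative_elem negative_elem (@negative_elem X))
    [D0 D0E] : 0 <= (0 : R) <= 1 by rewrite lexx ler01.
  have nontriv : {ae M D0, forall h : g_sigma_algebraType G,
      ~ trivial_classifier h} by apply: filterS (fair D0) => h [].
  apply: null_disagreements_trivial nontriv => //.
    by case: disc => [|/(_ D0)]; [left|right].
  move=> x x'; have mS := measurable_disagreement x x' hG.
  have /(three_points_distr negative_elem (x, false, true) (x', true, true))
    [D DE] : 0 <= t <= 1 by lra.
  apply: (private_null (D' := D) priv) => //.
    apply: distr_close_three_points DE; first by lra.
    by move=> z; rewrite D0E /three_points subr0 !mul0r.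
  apply: fair_null_disagreement fair _ => //.
  exists (1 - t), (t / 2); split=> [|E]; first by lra.
  by rewrite /distr_prob; under eq_esum do rewrite DE; rewrite esum_three_points//; lra.
Qed.
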